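(* Let $t_1\neq t_2$ be two single-token sequences and consider a benchmark dataset such that, for every prompt $s_q$ in the support of $P_Q$, the set of correct outputs $\textsc{c}(s_q)$ is a nonempty proper subset of $\{t_1,t_2\}$. Let $m$ and $m'$ be two large language models that (for every prompt) assign positive probability to each of the sequences $t_1$ and $t_2$ and zero probability to any other sequence. If the sampling mechanism defined by $f_T$ and $P_U$ satisfies counterfactual stability, then $$\mathrm{Var}\big[R_m(\mathbf{U},S_q)-R_{m'}(\mathbf{U}',S_q)\big] > \mathrm{Var}\big[R_m(\mathbf{U},S_q)-R_{m'}(\mathbf{U},S_q)\big],$$ where $S_q\sim P_Q$ and $\mathbf{U},\mathbf{U}'\sim P_{\mathbf{U}}$ are mutually independent.
   Context: $V$ is a finite vocabulary of tokens, $V^*$ the finite set of token sequences of length at most $K$, and $P_Q$ a distribution of prompts on $V^*$. The noise sequence is $\mathbf{U}=(U_1,\dots,U_K)$ with i.i.d. entries $U_i\sim P_U$; its law is $P_{\mathbf{U}}$. A model $m$ maps a sequence $s$ to a next-token distribution $f_D(s,m)\in\Delta(V)$. The sampling mechanism is a function $f_T$ together with $P_U$ such that, for $U\sim P_U$, the token $f_T(d,U)$ has distribution $d$ for every $d\in\Delta(V)$. For models that only output single-token sequences, the output on prompt $s_q$ under noise $\mathbf{u}$ is the single token $S_m(\mathbf{u},s_q)=f_T(f_D(s_q,m),u_1)$, so the probability that $m$ assigns to the single-token sequence $t$ on $s_q$ is $[f_D(s_q,m)]_t$. The score is $R_m(\mathbf{u},s_q)=\mathbf{1}\{S_m(\mathbf{u},s_q)\in\textsc{c}(s_q)\}\in\{0,1\}$,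 where $\textsc{c}(s_q)$ is the set of correct outputs for $s_q$. Counterfactual stability: for any two models, any next-token distributions $d$ (under the first model) and $d'$ (under the second model) at the same generation step, and any tokens $a\neq b$ in $V$ with $d(a),d(b)>0$: if $\frac{d'(a)}{d(a)}\ge\frac{d'(b)}{d(b)}$, then $P[f_T(d',U)=b \mid f_T(d,U)=a]=0$ for $U\sim P_U$ (the same noise value is used for $d$ and $d'$). *)

(* Defs.v *)
From mathcomp Require Import all_boot all_order all_algebra.
From mathcomp Require Import all_classical all_reals all_analysis.

Set Implicit Arguments.
Unset Strict Implicit.
Unset Printing Implicit Defensive.

Import Order.TTheory GRing.Theory Num.Theory.

Local Open Scope classical_set_scope.
Local Open Scope ring_scope.

Record simplex (R : realType) (T : finType) := Simplex {
  simplex_fun :> {ffun T -> R};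
  simplexP : [forall t, 0 <= simplex_fun t] && (\sum_t simplex_fun t == 1) }.

(* T carries the discrete sigma-algebra: measurability of X is that of its
   fibres. *)
Definition has_law (R : realType) (d : measure_display) (Omega : measurableType d)
    (P : probability Omega R) (T : finType) (X : Omega -> T)
    (p : simplex R T) : Prop :=
  forall t, measurable (X @^-1` [set t]) /\ P (X @^-1` [set t]) = (p t)%:E.

(* P[B | A], only meaningful when P A > 0. *)
Definition cond_prob (R : realType) (d : measure_display)
    (Omega : measurableType d) (P : probability Omega R)
    (B A : set Omega) : R :=
  fine (P (B `&` A)) / fine (P A).

Definition mutually_independent (R : realType) (d : measure_display)
    (Omega : measurableType d) (P : probability Omega R) (I : finType)
    (F : I -> set (set Omega)) : Prop :=
  (forall i A, F i A -> measurable A) /\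
  forall (J : {set I}) (A : I -> set Omega),
    (forall i, i \in J -> F i (A i)) ->
    P (\bigcap_(i in [set` J]) A i) = (\prod_(i in J) P (A i))%E.

(* The sigma-algebra of events generated by a random element whose codomain
   carries the sigma-algebra G. *)
Definition events_of (Omega T : Type) (X : Omega -> T) (G : set (set T)) :
    set (set Omega) :=
  preimage_set_system [set: Omega] X G.

Definition iid_entries (R : realType) (d dE : measure_display)
    (Omega : measurableType d) (E : measurableType dE) (K : nat)
    (P : probability Omega R) (PU : probability E R)
    (U : Omega -> K.-tuple E) : Prop :=
  (forall (i : 'I_K) (B : set E), measurable B ->
     P [set w | B (tnth (U w) i)] = PU B) /\
  mutually_independent P
    (fun i : 'I_K => events_of (fun w => tnth (U w) i) measurable).

(* The finite type of prompts carries the discrete sigma-algebra, and the noise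
   vectors the product one. *)
Definition independent_prompt_noises (R : realType) (d dE : measure_display)
    (Omega : measurableType d) (E : measurableType dE) (K : nat) (T : finType)
    (P : probability Omega R) (S : Omega -> T) (U U' : Omega -> K.-tuple E) :
    Prop :=
  mutually_independent P
    (fun i : 'I_3 => nth set0 [:: events_of S [set: set T];
                                  events_of U measurable;
                                  events_of U' measurable] i).

(* A model is any map from token sequences (of length at most K) to next-token
   distributions. *)
Definition model (R : realType) (V : finType) (K : nat) : Type :=
  K.-bseq V -> simplex R V.

Definition f_D (R : realType) (V : finType) (K : nat)
    (s : K.-bseq V) (m : model R V K) : simplex R V := m s.

Definition sampling_mechanism (R : realType) (V : finType)
    (dE : measure_display) (E : measurableType dE)
    (f_T : simplex R V -> E -> V) (PU : probability E R) : Prop :=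
  forall d : simplex R V, has_law PU (f_T d) d.

(* Since every function is a model, the next-token distributions of any two
   models at a generation step are any two points of the simplex. *)
Definition counterfactual_stability (R : realType) (V : finType)
    (dE : measure_display) (E : measurableType dE)
    (f_T : simplex R V -> E -> V) (PU : probability E R) : Prop :=
  forall (d d' : simplex R V) (a b : V),
    a != b -> 0 < d a -> 0 < d b ->
    d' b / d b <= d' a / d a ->
    cond_prob PU [set u | f_T d' u = b] [set u | f_T d u = a] = 0.

(* Output of a model restricted to single-token outputs; a single-token
   sequence is identified with its token, and only the first noise is used. *)
Definition output (R : realType) (V : finType) (K : nat) (K_gt0 : (0 < K)%N)
    (dE : measure_display) (E : measurableType dE)
    (f_T : simplex R V -> E -> V) (m : model R V K)
    (u : K.-tuple E) (s : K.-bseq V) : V :=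
  f_T (f_D s m) (tnth u (Ordinal K_gt0)).

Definition score (R : realType) (V : finType) (K : nat) (K_gt0 : (0 < K)%N)
    (dE : measure_display) (E : measurableType dE)
    (f_T : simplex R V -> E -> V) (c : K.-bseq V -> {set V})
    (m : model R V K) (u : K.-tuple E) (s : K.-bseq V) : R :=
  (output K_gt0 f_T m u s \in c s)%:R.

Definition supported_on_pair (R : realType) (V : finType) (K : nat)
    (t1 t2 : V) (m : model R V K) : Prop :=
  forall s : K.-bseq V,
    [/\ 0 < f_D s m t1, 0 < f_D s m t2 &
        forall t, t != t1 -> t != t2 -> f_D s m t = 0].

(* Main.v *)
(* Both differences of scores have the same marginals, so the claim reduces to
   P(both correct) being strictly larger with shared noise.  Conditionally on
   the prompt, only one of t1, t2 is correct; if p and q are its probabilities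
   under the two models, independent noise gives p * q, whereas stability
   forces the shared-noise samples to be monotonically coupled and gives
   min p q, which is larger than p * q because 0 < p, q < 1. *)
Require Import Defs.
From mathcomp Require Import all_boot all_order all_algebra.
From mathcomp Require Import all_classical all_reals all_analysis.

Set Implicit Arguments.
Unset Strict Implicit.
Unset Printing Implicit Defensive.

Import Order.TTheory GRing.Theory Num.Theory.

Local Open Scope classical_set_scope.
Local Open Scope ring_scope.

(** * Variance of a difference of two indicators *)

Lemma Lfun2_indic (R : realType) (d : measure_display) (T : measurableType d)
    (P : probability T R) (A : set T) :
  measurable A -> (\1_A : T -> R) \in Lfun P 2%:E.
Proof.
move=> mA; rewrite inE; apply/andP; split; rewrite inE/=.
  exact: measurable_realfun.measurable_indic.
rewrite /finite_norm unlock poweR_lty//.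
have -> : (\int[P]_x (`|(\1_A x : R)| `^ 2)%:E = \int[P]_x (\1_A x)%:E)%E.
  apply: eq_integral => x _; congr EFin.
  by rewrite indicE; case: (x \in A); rewrite ?normr1 ?powR1 ?normr0 ?powR0.
by rewrite integral_indic// setIT -ge0_fin_numE// fin_num_measure.
Qed.

(** Var(X - Y) = Var X + Var Y - 2 Cov(X, Y); a variance being the covariance of an indicator with
    itself, [covI] supplies all three terms. *)
Lemma varianceB_indic (R : realType) (d : measure_display)
    (T : measurableType d) (P : probability T R) (A B : set T) :
  measurable A -> measurable B ->
  'V_P[(\1_A \- \1_B : T -> R)%R] =
  ((P A - P A * P A) + (P B - P B * P B)
   - 2%:E * (P (A `&` B) - P A * P B))%E.
Proof.
move=> mA mB.
have covI C D : measurable C -> measurable D ->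
    covariance P (\1_C : T -> R) (\1_D : T -> R)
      = (P (C `&` D) - P C * P D)%E.
  move=> mC mD; have C2 := @Lfun2_indic R _ _ P C mC.
  have D2 := @Lfun2_indic R _ _ P D mD.
  have PT : P setT \is a fin_num by apply: fin_num_measure.
  rewrite covarianceE ?Lfun2_mul_Lfun1 ?(Lfun_subset12 PT)//.
  have -> : (\1_C * \1_D = \1_(C `&` D) :> (T -> R)).
    by rewrite indicI.
  by rewrite !expectation_indic//; exact: measurableI.
by rewrite varianceB ?Lfun2_indic// /variance !covI// !setIid.
Qed.

(** The marginal terms agree and cancel, so only -2 times the probability of the intersection
    differs: more overlap means less variance. *)
Lemma varianceB_indic_lt (R : realType) (d : measure_display)
    (T : measurableType d) (P : probability T R) (A B B' : set T) :
  measurable A -> measurable B -> measurable B' ->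
  P B = P B' -> (P (A `&` B') < P (A `&` B))%E ->
  ('V_P[(\1_A \- \1_B : T -> R)%R] < 'V_P[(\1_A \- \1_B' : T -> R)%R])%E.
Proof.
move=> mA mB mB' PB lt.
rewrite !varianceB_indic// -PB.
have [mI mI'] := (measurableI _ _ mA mB, measurableI _ _ mA mB').
move: lt; rewrite -(fineK (fin_num_measure P _ mA)).
rewrite -(fineK (fin_num_measure P _ mB)) -(fineK (fin_num_measure P _ mI)).
rewrite -(fineK (fin_num_measure P _ mI')).
rewrite !lte_fin => lt.
by rewrite ltrD2l ltrN2 ltr_pM2l// ltrD2r.
Qed.

(** * Slicing events along a map to a finite type *)

Lemma measurable_preimage_finType (d : measure_display) (T : measurableType d)
    (I : finType) (X : T -> I) (B : set I) :
  (forall i, measurable (X @^-1` [set i])) -> measurable (X @^-1` B).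
Proof.
move=> mX; have -> : X @^-1` B = \bigcup_(i in B) X @^-1` [set i].
  by apply/seteqP; split => [x Bx|x [i Bi /= ->]//]; exists (X x).
by apply: fin_bigcup_measurable => // i _; exact: mX.
Qed.

Lemma bigcup_fibres (T I : Type) (X : T -> I) (A : set T) :
  A = \bigcup_i (X @^-1` [set i] `&` A).
Proof.
by apply/seteqP; split => [x Ax|x [i _ []//]]; exists (X x).
Qed.

(** Law of total probability; it serves both for the random prompt and for the sampled token. *)
Lemma measure_fibres (R : realType) (d : measure_display)
    (T : measurableType d) (P : probability T R) (I : finType) (X : T -> I)
    (A : set T) :
  (forall i, measurable (X @^-1` [set i])) -> measurable A ->
  P A = (\sum_i P (X @^-1` [set i] `&` A))%E.
Proof.
move=> mX mA; rewrite [in LHS](bigcup_fibres X A) measure_fin_bigcup//.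
- rewrite (@fsbigE _ _ _ _ _ (index_enum I)) ?index_enum_uniq//; last first.
    by move=> i _; rewrite mem_index_enum.
  by apply: eq_bigl => i; rewrite in_setT.
- exact: finite_finset.
- by move=> i j _ _ [x [[/= <- _] [/= <- _]]].
- by move=> i _; apply: measurableI.
Qed.

(** In the total probability formula the slice over [b] is null by hypothesis and those over other
    points because [p] vanishes there; only the slice over [a] remains. *)
Lemma measure_fibre_pair (R : realType) (d : measure_display)
    (T : measurableType d) (P : probability T R) (I : finType) (X : T -> I)
    (p : simplex R I) (a b : I) (A : set T) :
  has_law P X p -> (forall i, i != a -> i != b -> p i = 0) -> a != b ->
  measurable A -> P (X @^-1` [set b] `&` A) = 0%E ->
  P (X @^-1` [set a] `&` A) = P A.
Proof.
move=> lawX p0 ab mA PbA.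
rewrite [RHS](measure_fibres P (fun i => (lawX i).1) mA).
rewrite (bigD1 a)//= big1 ?adde0// => i ia.
have [->//|ib] := eqVneq i b.
apply/eqP; rewrite eq_le measure_ge0 andbT.
rewrite (_ : 0%E = P (X @^-1` [set i])); last by rewrite (lawX i).2 p0.
by apply: le_measure; rewrite ?inE//; [apply: measurableI => //|]; exact: (lawX i).1.
Qed.

(** [cond_prob] is a real quotient, where the inverse of 0 is 0; [0 < P A] ensures that the
    numerator is what vanishes. *)
Lemma cond_prob_eq0 (R : realType) (d : measure_display)
    (T : measurableType d) (P : probability T R) (A B : set T) :
  measurable A -> measurable B -> (0 < P A)%E ->
  cond_prob P B A = 0 -> P (B `&` A) = 0%E.
Proof.
move=> mA mB PA /eqP.
have PA0 : 0 < fine (P A) by rewrite fine_gt0// PA ltey_eq fin_num_measure.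
rewrite mulf_eq0 invr_eq0 (gt_eqF PA0) orbF => /eqP PBA.
by rewrite -[LHS]fineK ?PBA//; apply: fin_num_measure; exact: measurableI.
Qed.

(** * Two-point next-token distributions under stability *)

Lemma simplex_ge0 (R : realType) (T : finType) (p : simplex R T) t : 0 <= p t.
Proof. by case/andP: (simplexP p) => /forallP. Qed.

Lemma simplex_lt1 (R : realType) (T : finType) (p : simplex R T) (a b : T) :
  a != b -> 0 < p b -> p a < 1.
Proof.
move=> ab pb; case/andP: (simplexP p) => _ /eqP <-.
rewrite (bigD1 a)//= (bigD1 b) 1?eq_sym//= ltrDl.
by rewrite ltr_pwDl// sumr_ge0// => i _; exact: simplex_ge0.
Qed.

(* Stability rules out one of the two disagreements (a, b), (b, a) of the
   coupled samples, so that they agree on a with probability min (d a) (d' a). *)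
Lemma stability_coupling (R : realType) (V : finType) (dE : measure_display)
    (E : measurableType dE) (f_T : simplex R V -> E -> V)
    (PU : probability E R) (d d' : simplex R V) (a b : V) :
  sampling_mechanism f_T PU -> counterfactual_stability f_T PU -> a != b ->
  [/\ 0 < d a, 0 < d b & forall t, t != a -> t != b -> d t = 0] ->
  [/\ 0 < d' a, 0 < d' b & forall t, t != a -> t != b -> d' t = 0] ->
  (PU (f_T d @^-1` [set a]) * PU (f_T d' @^-1` [set a])
   < PU (f_T d @^-1` [set a] `&` f_T d' @^-1` [set a]))%E.
Proof.
move=> fT cs ab [da db d0] [d'a d'b d'0].
have law e t := (fT e t).2; have mfib e t : measurable _ := (fT e t).1.
(* If the ratio at [a] is at least that at [b], sampling [a] from [d] forces [a] from [d'] almost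
   surely. The joint event then has probability [d a], above [d a * d' a] since [d' a < 1]. *)
have [le|/ltW le] := leP (d' b / d b) (d' a / d a).
  have Pba := cond_prob_eq0 (mfib d a) (mfib d' b) _ (cs _ _ _ _ ab da db le).
  rewrite setIC (measure_fibre_pair (fT d') d'0 ab) ?Pba ?law ?lte_fin//.
  by rewrite gtr_pMr// (simplex_lt1 ab).
(* Stability with [a] and [b] exchanged: now [a] from [d'] forces [a] from [d], and the joint
   probability is [d' a]. *)
have ba : b != a by rewrite eq_sym.
have Pab := cond_prob_eq0 (mfib d b) (mfib d' a) _ (cs _ _ _ _ ba db da le).
rewrite (measure_fibre_pair (fT d) d0 ab) ?law//.
  by rewrite lte_fin gtr_pMl// (simplex_lt1 ab).
by rewrite setIC Pab ?law ?lte_fin.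
Qed.

(** * Joint law of prompt and noises; shape of the correct sets *)

Lemma prompt_noises_indep (R : realType) (d dE : measure_display)
    (Omega : measurableType d) (E : measurableType dE) (K : nat) (T : finType)
    (P : probability Omega R) (S : Omega -> T) (U U' : Omega -> K.-tuple E)
    (s : T) (C D : set (K.-tuple E)) :
  independent_prompt_noises P S U U' -> measurable C -> measurable D ->
  P (S @^-1` [set s] `&` (U @^-1` C `&` U' @^-1` D)) =
  (P (S @^-1` [set s]) * (P (U @^-1` C) * P (U' @^-1` D)))%E.
Proof.
move=> [_ indep] mC mD.
pose F := [:: S @^-1` [set s]; U @^-1` C; U' @^-1` D].
(* The product formula is taken for the full index set, with the three events listed in [F]. *)
have := indep [set: 'I_3]%SET (fun i => nth set0 F i).
have -> : \bigcap_(i in [set` [set: 'I_3]%SET]) nth set0 F i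
    = S @^-1` [set s] `&` (U @^-1` C `&` U' @^-1` D).
  apply/seteqP; split => [w Fw|w [Sw [Uw U'w]] [[|[|[|//]]] lti] _]//=.
  split; first exact: (Fw (@Ordinal 3 0 isT) (finset.in_setT _)).
  by split; [exact: (Fw (@Ordinal 3 1 isT) (finset.in_setT _))
            |exact: (Fw (@Ordinal 3 2 isT) (finset.in_setT _))].
move=> ->; last first.
  move=> [[|[|[|//]]] lti] _ /=.
  - by exists [set s]; rewrite ?setTI.
  - by exists C; rewrite ?setTI.
  - by exists D; rewrite ?setTI.
rewrite (eq_bigl xpredT) => [|i]; last by rewrite finset.in_setT.
by rewrite !big_ord_recl big_ord0/= mule1.
Qed.

(** The cardinality is positive and smaller than that of a set with at most two elements, so [C] is
    a singleton. *)
Lemma proper_subset_pair (V : finType) (t1 t2 : V) (C : {set V}) :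
  C != finset.set0 -> C \proper [set t1; t2]%SET ->
  C = [set t1]%SET \/ C = [set t2]%SET.
Proof.
move=> C0 CP; have /cards1P[x Cx] : #|C| == 1%N.
  rewrite eqn_leq card_gt0 C0 andbT -ltnS.
  by rewrite (leq_trans (proper_card CP))// cards2; case: (_ != _).
have : x \in [set t1; t2]%SET.
  by apply: (fintype.subsetP (proper_sub CP)); rewrite Cx set11.
by rewrite Cx !inE => /orP[] /eqP ->; [left|right].
Qed.

Theorem proposition2 (R : realType) (V : finType) (K : nat) (K_gt0 : (0 < K)%N)
    (dE : measure_display) (E : measurableType dE) (PU : probability E R)
    (f_T : simplex R V -> E -> V)
    (PQ : simplex R (K.-bseq V)) (c : K.-bseq V -> {set V})
    (t1 t2 : V) (m m' : model R V K)
    (dO : measure_display) (Omega : measurableType dO) (P : probability Omega R)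
    (S : Omega -> K.-bseq V) (U U' : {RV P >-> K.-tuple E}) :
  sampling_mechanism f_T PU ->
  t1 != t2 ->
  (forall s : K.-bseq V, 0 < PQ s ->
     c s != finset.set0 /\ c s \proper [set t1; t2]%SET) ->
  supported_on_pair t1 t2 m ->
  supported_on_pair t1 t2 m' ->
  counterfactual_stability f_T PU ->
  has_law P S PQ ->
  iid_entries P PU U ->
  iid_entries P PU U' ->
  independent_prompt_noises P S U U' ->
  ('V_P[(fun w => score K_gt0 f_T c m (U w) (S w)
                 - score K_gt0 f_T c m' (U' w) (S w))%R]
   > 'V_P[(fun w => score K_gt0 f_T c m (U w) (S w)
                   - score K_gt0 f_T c m' (U w) (S w))%R])%E.
Proof.
move=> fT t12 ct m12 m'12 cs lawS [Ulaw _] [U'law _] indep.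
pose i0 := Ordinal K_gt0.
(* [C n s] lives in the space of a single noise, for a fixed prompt; [A n W] is the corresponding
   event in [Omega], with random prompt and noise. *)
pose C (n : model R V K) s := [set e : E | f_T (f_D s n) e \in c s].
pose A n (W : Omega -> K.-tuple E) :=
  [set w | f_T (f_D (S w) n) (tnth (W w) i0) \in c (S w)].
have mC n s : measurable (C n s).
  apply: (@measurable_preimage_finType _ _ _ (f_T (f_D s n)) [set` c s]).
  by move=> t; case: (fT (f_D s n) t).
have mtnth (B : set E) : measurable B ->
    measurable [set u : K.-tuple E | B (tnth u i0)].
  by move=> mB; rewrite -[X in measurable X]setTI; apply: measurable_tnth.
have mS s : measurable (S @^-1` [set s]) by case: (lawS s).
(* Once the prompt is fixed, correctness depends on the first noise entry alone. *)
have fibreA n W s : S @^-1` [set s] `&` A n W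
    = S @^-1` [set s] `&` W @^-1` [set u | C n s (tnth u i0)].
  by apply/seteqP; split=> w [/= <-].
have mA n (W : {RV P >-> K.-tuple E}) : measurable (A n W).
  rewrite (bigcup_fibres S (A n W)); apply: fin_bigcup_measurable.
    exact: finite_finset.
  move=> s _; rewrite fibreA; apply: measurableI => //.
  rewrite -[X in measurable X]setTI; apply: measurable_funP => //.
  exact: mtnth.
have scoreE n n' (W W' : Omega -> K.-tuple E) :
    (fun w => score K_gt0 f_T c n (W w) (S w)
              - score K_gt0 f_T c n' (W' w) (S w))
    = (\1_(A n W) \- \1_(A n' W') : Omega -> R).
  by apply/funext => w; rewrite /= !indicE !mem_setE.
have joint s (B B' : set E) : measurable B -> measurable B' ->
    P (S @^-1` [set s] `&` (U @^-1` [set u | B (tnth u i0)]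
                       `&` U' @^-1` [set u | B' (tnth u i0)]))
    = ((PQ s)%:E * (PU B * PU B'))%E.
  move=> mB mB'; rewrite (prompt_noises_indep s indep (mtnth _ mB) (mtnth _ mB')).
  by rewrite (lawS s).2 (Ulaw i0 _ mB) (U'law i0 _ mB').
have jointU s (B : set E) : measurable B ->
    P (S @^-1` [set s] `&` U @^-1` [set u | B (tnth u i0)])
    = ((PQ s)%:E * PU B)%E.
  (* The marginal in [U] comes from the full event for [U']. *)
  move=> mB; have := joint s B setT mB measurableT.
  by rewrite preimage_setT setIT probability_setT mule1.
have jointU' s (B : set E) : measurable B ->
    P (S @^-1` [set s] `&` U' @^-1` [set u | B (tnth u i0)])
    = ((PQ s)%:E * PU B)%E.
  move=> mB; have := joint s setT B measurableT mB.
  by rewrite preimage_setT setTI probability_setT mul1e.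
(* The two events of [m'] have equal probability, since [U] and [U'] have the same law on each
   prompt slice. *)
rewrite !scoreE; apply: varianceB_indic_lt => //.
  rewrite (measure_fibres P mS (mA m' U)) (measure_fibres P mS (mA m' U')).
  by apply: eq_bigr => s _; rewrite !fibreA jointU ?jointU'.
have strict s : 0 < PQ s ->
    (PU (C m s) * PU (C m' s) < PU (C m s `&` C m' s))%E.
  move=> /ct[c0 cP].
  have Ct n t : c s = [set t]%SET -> C n s = f_T (f_D s n) @^-1` [set t].
    by move=> cs1; apply/seteqP; split=> e; rewrite /C /= cs1 !inE => /eqP.
  have [cst|cst] := proper_subset_pair c0 cP; rewrite !(Ct _ _ cst).
    exact: (stability_coupling fT cs t12 (m12 s) (m'12 s)).
  (* When [t2] is the correct token, the coupling is applied with the two tokens exchanged. *)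
  have swap (n : model R V K) : supported_on_pair t1 t2 n ->
      [/\ 0 < f_D s n t2, 0 < f_D s n t1 &
          forall t, t != t2 -> t != t1 -> f_D s n t = 0].
    by case/(_ s) => ? ? n0; split=> // t ? ?; apply: n0.
  have t21 : t2 != t1 by rewrite eq_sym.
  exact: (stability_coupling fT cs t21 (swap _ m12) (swap _ m'12)).
have fibreI s : S @^-1` [set s] `&` (A m U `&` A m' U)
    = S @^-1` [set s] `&` U @^-1` [set u | (C m s `&` C m' s) (tnth u i0)].
  by apply/seteqP; split=> w [/= <-].
have fibreI' s : S @^-1` [set s] `&` (A m U `&` A m' U')
    = S @^-1` [set s] `&` (U @^-1` [set u | C m s (tnth u i0)]
                       `&` U' @^-1` [set u | C m' s (tnth u i0)]).
  by apply/seteqP; split=> w [/= <-].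
(* Prompt masses sum to 1, so some prompt is charged; it provides the strict term of the sum. *)
have [s0 s0_gt0] : exists s, 0 < PQ s.
  apply: contrapT => /forallNP PQ0.
  have PQs s : PQ s = 0.
    by apply/eqP; rewrite eq_le simplex_ge0 andbT leNgt; apply/negP.
  case/andP: (simplexP PQ) => _; rewrite big1 => [|s _ //].
  by rewrite eq_sym oner_eq0.
rewrite (measure_fibres P mS (measurableI _ _ (mA m U) (mA m' U))).
rewrite (measure_fibres P mS (measurableI _ _ (mA m U) (mA m' U'))).
have lt s : 0 < PQ s -> (P (S @^-1` [set s] `&` (A m U `&` A m' U'))
    < P (S @^-1` [set s] `&` (A m U `&` A m' U)))%E.
  move=> PQs; rewrite fibreI' joint// fibreI jointU; last exact: measurableI.
  by rewrite lte_pmul2l ?lte_fin//; exact: strict.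
(* The inequality is strict at [s0] and weak elsewhere: an uncharged prompt has a null slice on the
   left. Adding the two inequalities in the extended reals also requires the remaining sum to be
   finite. *)
rewrite (bigD1 s0)//= [ltRHS](bigD1 s0)//=; apply: lte_leD; last 2 first.
- exact: lt.
- apply: lee_sum => s _; have := simplex_ge0 PQ s.
  rewrite le_eqVlt => /orP[/eqP PQs|/lt/ltW//].
  by rewrite fibreI' joint// -PQs mul0e measure_ge0.
apply/sum_fin_numP => s _ _; apply: fin_num_measure.
by apply: measurableI => //; exact: measurableI.
Qed.
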